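(* Let $B = \{(i,j) \in [1,2] \times [1,2] : j < i\}$, where $[1,2]$ is the real interval, let $A = B \cup [1,2]$ (a disjoint union, regarded as an alphabet), and let $A^*$ be the free monoid on $A$. Let $\rho$ be the relation on $A^*$ consisting of the pairs $((i,j)^2, i)$ and $((i,j)^3, j)$ for all $(i,j) \in B$, where $(i,j)^2$ and $(i,j)^3$ denote the words of length $2$ and $3$ in the single letter $(i,j)$, and $i$, $j$ denote the corresponding one-letter words. Let $\rho^{\#}$ be the smallest congruence on $A^*$ containing $\rho$. Then the chromatic number $\chi(\mathcal{P}_e(A^*/\rho^{\#}))$ of the enhanced power graph of the semigroup $A^*/\rho^{\#}$ is uncountable.
   Context: For a semigroup $S$ and $z \in S$, $\langle z \rangle = \{z^m : m \geq 1\}$ is the subsemigroup generated by $z$. The enhanced power graph $\mathcal{P}_e(S)$ of a semigroup $S$ is the simple undirected graph with vertex set $S$ in which two distinct vertices $x, y$ are adjacent if and only if $x, y \in \langle z \rangle$ for some $z \in S$. A congruence on a semigroup is an equivalence relation compatible with multiplication, and $A^*/\rho^{\#}$ is the quotient semigroup with $(a\rho^{\#})(b\rho^{\#}) = (ab)\rho^{\#}$. The chromatic number of a graph is the least cardinality of a set of colours admitting a proper vertex colouring. *)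

(* Defs.v *)
From HB Require Import structures.
From mathcomp Require Import all_boot all_order all_algebra.
From mathcomp Require Import boolp classical_sets cardinality reals.

Set Implicit Arguments.
Unset Strict Implicit.
Unset Printing Implicit Defensive.

Local Open Scope classical_set_scope.
Local Open Scope card_scope.
Local Open Scope quotient_scope.

Record graph (V : Type) := Graph {
  adj : V -> V -> Prop;
  adj_sym : forall x y, adj x y -> adj y x;
  adj_irrefl : forall x, ~ adj x x }.

Definition proper_colouring V (G : graph V) K (C : set K) (c : V -> K) : Prop :=
  (forall v, C (c v)) /\ (forall x y, adj G x y -> c x <> c y).

Definition colourable V (G : graph V) K (C : set K) : Prop :=
  exists c : V -> K, proper_colouring G C c.

(* The cardinality of C is the least one of a set of colours for G; the
   competing sets D of colours range over all types. *)
Definition is_chromatic_number V (G : graph V) K (C : set K) : Prop :=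
  colourable G C /\
  forall (L : Type) (D : set L), colourable G D -> C #<= D.

(* A cardinal is represented, up to equipotence, by a set having that
   cardinality. The vertices themselves form a set of colours, so a set of
   vertices of the least cardinality can be chosen; this is justified by
   chromatic_numberP and chromatic_number_unique below. *)
Definition chromatic_number V (G : graph V) : set V :=
  get [set C : set V | is_chromatic_number G C].

Lemma card_le_inj T U (f : T -> U) (A : set T) (B : set U) :
  (forall x, A x -> B (f x)) ->
  (forall x y, A x -> A y -> f x = f y -> x = y) -> A #<= B.
Proof.
move=> fAB finj; apply: (@card_le_trans _ _ _ (f @` A)).
  rewrite -(card_le_eql (inj_card_eq (f := f) _)) ?card_lexx //.
  by move=> x y /set_mem Ax /set_mem Ay; apply: finj.
by apply: subset_card_le => _ [x Ax <-]; apply: fAB.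
Qed.

Lemma least_cardinality V (P : set (set V)) :
  P !=set0 -> exists2 C, P C & forall D, P D -> C #<= D.
Proof.
move=> [C0 PC0]; pose I := {D : set V | P D}.
pose Q (M : set (I -> V)) := (forall f, M f -> forall i, sval i (f i)) /\
  (forall f g, M f -> M g -> forall i, f i = g i -> f = g).
have [F FQ Ftot|M [[M1 M2] Mmax]] := @Zorn_bigcup _ Q.
  split; first by move=> f [X FX Xf]; apply: (FQ X FX).1.
  move=> f g [X FX Xf] [Y FY Yg].
  have [XY|YX] := Ftot _ _ FX FY.
    by apply: (FQ Y FY).2 => //; apply: XY.
  by apply: (FQ X FX).2 => //; apply: YX.
have [[i Msurj]|] :=
    pselect (exists i : I, forall v, sval i v -> exists2 f, M f & f i = v).
  exists (sval i); first exact: (svalP i).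
  move=> D PD; pose j : I := exist _ D PD.
  have hex v : exists w, sval i v -> exists f, [/\ M f, f i = v & f j = w].
    have [/Msurj[f Mf fv]|niv] := pselect (sval i v); last by exists v.
    by exists (f j) => _; exists f.
  have [h hP] := choice hex.
  apply: (@card_le_inj _ _ h).
    by move=> v /hP[f [Mf _ <-]]; apply: (M1 f Mf j).
  move=> v w /hP[f [Mf <- fh]] /hP[g [Mg <- gh]] hh.
  by rewrite (M2 f g Mf Mg j) // fh gh.
move=> nsurj.
have gex i : exists v, sval i v /\ forall f, M f -> f i <> v.
  apply: contra_notP nsurj => nv; exists i => v iv.
  apply: contra_notP nv => nf; exists v; split => // f Mf fv.
  by apply: nf; exists f.
have [g gP] := choice gex.
case: (Mmax (M `|` [set g])).
  split; first by move=> f; left.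
  move=> /(_ g (or_intror erefl)) Mg.
  by case: (gP (exist _ C0 PC0)) => _ /(_ g Mg).
split; first by move=> f [Mf|->] i; [exact: M1|exact: (gP i).1].
move=> f f' [Mf|->] [Mf'|->] i // e; first exact: (M2 f f' Mf Mf' i).
  by case: ((gP i).2 f Mf).
by case: ((gP i).2 f' Mf').
Qed.

Lemma chromatic_numberP V (G : graph V) :
  is_chromatic_number G (chromatic_number G).
Proof.
suff : exists C : set V, is_chromatic_number G C by apply: getPex.
have [|C GC Cmin] := @least_cardinality V (fun C => colourable G C).
  exists setT; exists id; split => // x y xy exy.
  by apply: (@adj_irrefl _ G x); rewrite {2}exy.
exists C; split => // L D [c [cD cG]].
(* s picks one vertex in each colour class *)
have [s sP] : exists s : V -> V, forall v, c (s v) = c v /\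
    forall w, c v = c w -> s v = s w.
  have [v0|nV] := pselect (inhabited V); last first.
    by exists id => v; case: nV; exists.
  have hex l : exists w, (exists v, c v = l) -> c w = l.
    have [[v <-]|nl] := pselect (exists v, c v = l); first by exists v.
    by case: v0 => v; exists v => /nl.
  have [h hP] := choice hex.
  exists (h \o c) => v; split => [|w /= -> //]; by apply: hP; exists v.
apply: (@card_le_trans _ _ _ (range s)).
  apply: Cmin; exists s; split => [v|x y /cG cxy sxy]; first by exists v.
  by apply: cxy; rewrite -(sP x).1 sxy (sP y).1.
apply: (@card_le_inj _ _ c) => // _ _ [v _ <-] [w _ <-].
by rewrite (sP v).1 (sP w).1; apply: (sP v).2.
Qed.

Lemma chromatic_number_unique V (G : graph V) K (C : set K) :
  is_chromatic_number G C -> C #= chromatic_number G.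
Proof.
move=> [GC Cmin]; have [Gchi chimin] := chromatic_numberP G.
by rewrite card_eq_le Cmin // chimin.
Qed.

(* For 0 < m, iterop m *%g z z is the product of m factors z; the power
   z ^+ m is only available in the presence of a unit. *)
Definition gen_subsemigroup (S : semigroupType) (z : S) : set S :=
  [set x | exists2 m, (0 < m)%N & x = iterop m *%g z z].

Definition enhanced_power_adj (S : semigroupType) (x y : S) : Prop :=
  x <> y /\ exists z : S, gen_subsemigroup z x /\ gen_subsemigroup z y.

Lemma enhanced_power_adj_sym (S : semigroupType) (x y : S) :
  enhanced_power_adj x y -> enhanced_power_adj y x.
Proof. by move=> [xy [z [zx zy]]]; split; [exact/nesym|exists z]. Qed.

Lemma enhanced_power_adj_irrefl (S : semigroupType) (x : S) :
  ~ enhanced_power_adj x x.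
Proof. by case. Qed.

Definition enhanced_power_graph (S : semigroupType) : graph S :=
  Graph (@enhanced_power_adj_sym S) (@enhanced_power_adj_irrefl S).

Definition congruence (S : semigroupType) (r : S -> S -> Prop) : Prop :=
  [/\ forall x, r x x,
      forall x y, r x y -> r y x,
      forall x y z, r x y -> r y z -> r x z &
      forall x x' y y', r x x' -> r y y' -> r (x * y)%g (x' * y')%g].

Definition gen_congruence (S : semigroupType) (rho : S -> S -> Prop)
    (x y : S) : Prop :=
  forall r : S -> S -> Prop, congruence r ->
    (forall u v, rho u v -> r u v) -> r x y.

Lemma gen_congruence_congruence (S : semigroupType) (rho : S -> S -> Prop) :
  congruence (gen_congruence rho).
Proof.
split=> [x|x y xy|x y z xy yz|x x' y y' xx' yy'] r rC rr;
  case: (rC) => r1 r2 r3 r4.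
- exact: r1.
- by apply: r2; apply: (xy r).
- by apply: (r3 _ y); [apply: (xy r)|apply: (yz r)].
- by apply: r4; [apply: (xx' r)|apply: (yy' r)].
Qed.

Definition gen_congruenceb (S : semigroupType) (rho : S -> S -> Prop) : rel S :=
  fun x y => `[< gen_congruence rho x y >].

Lemma gen_congruenceb_refl (S : semigroupType) (rho : S -> S -> Prop) :
  reflexive (gen_congruenceb rho).
Proof. by move=> x; apply/asboolP; case: (gen_congruence_congruence rho). Qed.

Lemma gen_congruenceb_sym (S : semigroupType) (rho : S -> S -> Prop) :
  symmetric (gen_congruenceb rho).
Proof.
have [_ rs _ _] := gen_congruence_congruence rho.
by move=> x y; apply/asboolP/asboolP; apply: rs.
Qed.

Lemma gen_congruenceb_trans (S : semigroupType) (rho : S -> S -> Prop) :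
  transitive (gen_congruenceb rho).
Proof.
have [_ _ rt _] := gen_congruence_congruence rho.
by move=> y x z /asboolP xy /asboolP yz; apply/asboolP; apply: rt xy yz.
Qed.

Canonical gen_congruenceb_equiv (S : semigroupType) (rho : S -> S -> Prop) :=
  EquivRel (gen_congruenceb rho) (@gen_congruenceb_refl S rho)
    (@gen_congruenceb_sym S rho) (@gen_congruenceb_trans S rho).

Definition quotient_semigroup (S : semigroupType) (rho : S -> S -> Prop) :=
  {eq_quot gen_congruenceb rho}.

HB.instance Definition _ (S : semigroupType) (rho : S -> S -> Prop) :=
  Choice.on (quotient_semigroup rho).
HB.instance Definition _ (S : semigroupType) (rho : S -> S -> Prop) :=
  EqQuotient.on (quotient_semigroup rho).

Definition quotient_mul (S : semigroupType) (rho : S -> S -> Prop) :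
    quotient_semigroup rho -> quotient_semigroup rho -> quotient_semigroup rho :=
  lift_op2 (quotient_semigroup rho) *%g.

Lemma quotient_mul_pi (S : semigroupType) (rho : S -> S -> Prop) (x y : S) :
  quotient_mul (\pi_(quotient_semigroup rho) x) (\pi_(quotient_semigroup rho) y)
  = \pi_(quotient_semigroup rho) (x * y)%g.
Proof.
have [_ _ _ rM] := gen_congruence_congruence rho.
have eqP u v := @eqquotP S (gen_congruenceb rho) (quotient_semigroup rho) u v.
unlock quotient_mul; apply/eqP/asboolP.
by apply: rM; apply/asboolP/eqP; rewrite reprK.
Qed.

Lemma quotient_mulA (S : semigroupType) (rho : S -> S -> Prop) :
  associative (@quotient_mul S rho).
Proof.
move=> x y z; rewrite -(reprK x) -(reprK y) -(reprK z).
by rewrite !quotient_mul_pi mulgA.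
Qed.

HB.instance Definition _ (S : semigroupType) (rho : S -> S -> Prop) :=
  isSemigroup.Build (quotient_semigroup rho) (@quotient_mulA S rho).

Definition free_monoid (A : Type) := seq A.

HB.instance Definition _ (A : choiceType) := Choice.on (free_monoid A).
HB.instance Definition _ (A : choiceType) :=
  isMonoid.Build (free_monoid A) (@catA A) (@cat0s A) (@cats0 A).

Definition I12 (R : realType) := {x : R | (1 <= x <= 2)%R}.

Definition B12 (R : realType) :=
  {p : I12 R * I12 R | (val p.2 < val p.1)%R}.

(* inl injects the letters (i, j) of B, inr the letters of [1, 2]. *)
Definition alphabet (R : realType) : choiceType := (B12 R + I12 R)%type.

Inductive rho (R : realType) :
    free_monoid (alphabet R) -> free_monoid (alphabet R) -> Prop :=
| rho_square (b : B12 R) : rho [:: inl b; inl b] [:: inr (val b).1]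
| rho_cube (b : B12 R) : rho [:: inl b; inl b; inl b] [:: inr (val b).2].

Arguments rho R : clear implicits.

(* Main.v *)
(** The letters i of [1,2] form a clique, because (i,j)^2 = i and (i,j)^3 = j.
    They stay distinct in the quotient: the words equal to the letter j are the
    word j, the squares of the letters (j,_), and the products in either order
    of a letter (k,j) and a word equal to k; this set contains no other
    one-letter word of [1,2], and its syntactic congruence contains rho. *)
Require Import Defs.
From mathcomp Require Import all_boot all_order all_algebra.
From mathcomp Require Import boolp classical_sets cardinality reals.
From mathcomp Require Import ereal lebesgue_measure.

Set Implicit Arguments.
Unset Strict Implicit.
Unset Printing Implicit Defensive.

Import Order.TTheory GRing.Theory Num.Theory.

Definition syntactic (S : monoidType) (X : S -> Prop) (x y : S) : Prop :=
  forall u v, X (u * x * v)%g <-> X (u * y * v)%g.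

Lemma syntactic_congruence (S : monoidType) (X : S -> Prop) :
  congruence (syntactic X).
Proof.
split=> [x u v //|x y xy u v|x y z xy yz u v|x x' y y' xx' yy' u v].
- exact: iff_sym.
- exact: iff_trans (xy u v) (yz u v).
- have := xx' u (y * v)%g; have := yy' (u * x')%g v; rewrite !mulgA => e1 e2.
  exact: iff_trans e2 e1.
Qed.

(** The syntactic congruence is one of the congruences intersected in [gen_congruence r]; the empty
    context then recovers [X] itself. *)
Lemma gen_congruence_syntactic (S : monoidType) (r : S -> S -> Prop)
    (X : S -> Prop) x y :
  (forall a b, r a b -> syntactic X a b) ->
  gen_congruence r x y -> X x <-> X y.
Proof.
move=> rX /(_ _ (syntactic_congruence X) rX) /(_ 1%g 1%g).
by rewrite !mul1g !mulg1.
Qed.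

Section LetterClass.
Variable R : realType.
Implicit Types (i j k : I12 R) (b c : B12 R) (w u v : seq (alphabet R)).

(** Words grow only at their two ends, so a factor can be followed through a derivation by peeling
    off end letters. Cubes arise from a square by one such step. *)
Inductive letter_class : I12 R -> seq (alphabet R) -> Prop :=
| letter_class_letter j : letter_class j [:: inr j]
| letter_class_square b : letter_class (val b).1 [:: inl b; inl b]
| letter_class_cons b w : letter_class (val b).1 w ->
    letter_class (val b).2 (inl b :: w)
| letter_class_rcons b w : letter_class (val b).1 w ->
    letter_class (val b).2 (rcons w (inl b)).

Definition top (a : alphabet R) : I12 R :=
  match a with inl b => (val b).1 | inr i => i end.

(** Adding a letter [b] lowers the index strictly, from [(val b).1] to [(val b).2]. Hence equality
    survives only in the two base cases. *)
Lemma letter_class_top j w a : letter_class j w -> a \in w ->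
  (val j <= val (top a))%R /\
  (top a = j -> w = if a is inl _ then [:: a; a] else [:: a]).
Proof.
have lt_top b x : (val (val b).1 <= val x)%R ->
    (val (val b).2 <= val x)%R /\ (x = (val b).2 -> False).
  move=> bx; have jx := lt_le_trans (valP b) bx.
  by split; [exact: ltW|move=> e; rewrite e ltxx in jx].
move=> jw; elim: jw a => {j w} [j|b|b w _ IH|b w _ IH] a.
- by rewrite inE => /eqP->.
- by rewrite !inE orbb => /eqP->.
- rewrite inE => /orP[/eqP->|/IH[/lt_top[? ne] _]]; last by split=> // /ne.
  by have [? ne] := lt_top b (val b).1 (lexx _); split=> // /ne.
- rewrite mem_rcons inE => /orP[/eqP->|/IH[/lt_top[? ne] _]].
    by have [? ne] := lt_top b (val b).1 (lexx _); split=> // /ne.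
  by split=> // /ne.
Qed.

Lemma letter_class_inr j k : letter_class j [:: inr k] -> k = j.
Proof.
move e: [:: inr k] => w jw; case: jw e => [i [->] //|//|//|b [|a [|??]] //].
Qed.

(** Either the square lies inside the shorter word, where induction applies, or it contains the end
    letter added last; then the whole word must be the cube of [b]. *)
Lemma letter_class_square_contract j b u v :
  letter_class j (u ++ [:: inl b; inl b] ++ v) ->
  letter_class j (u ++ [:: inr (val b).1] ++ v).
Proof.
move e: (u ++ _) => w jw; elim: jw u v e => {j w} [j|c|c w cw IH|c w cw IH] u v.
- by case: u => [|? [|? ?]].
- case: u => [|a [|? [|? ?]]] //=; case: v => [|? ?] //= [->] _.
  exact: letter_class_letter.
- case: u => [|a u] /= [].
    (* The shorter word starts with [b] and has index [top (inl b)], so it is the square of [b]. *)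
    move=> -> e; rewrite -e in cw.
    have [|_ /(_ erefl)] := letter_class_top (a := inl c) cw.
      exact: mem_head.
    case=> ->; apply: (@letter_class_rcons _ [:: _]).
    exact: letter_class_letter.
  by move=> -> e; apply: letter_class_cons; apply: IH.
(* Mirror image, peeling off the last letter. *)
- case/lastP: v => [|v a].
    rewrite cats0 -[[:: inl b; inl b]]/(rcons [:: inl b] (inl b)) -rcons_cat.
    move=> /rcons_inj[e bc]; subst c; rewrite -e in cw.
    have [|_ /(_ erefl)] := letter_class_top (a := inl b) cw.
      by rewrite mem_cat mem_head orbT.
    case: u cw {e} => [|x [|y [|z u]]] //= _ [->].
    by apply: letter_class_cons; exact: letter_class_letter.
  rewrite -!rcons_cat => /rcons_inj[e ->].
  by apply: letter_class_rcons; apply: IH.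
Qed.

(** An added end letter lies in B, so it is never the letter being expanded; that letter is the
    whole word or lies in the shorter one. *)
Lemma letter_class_square_expand j b u v :
  letter_class j (u ++ [:: inr (val b).1] ++ v) ->
  letter_class j (u ++ [:: inl b; inl b] ++ v).
Proof.
move e: (u ++ _) => w jw; elim: jw u v e => {j w} [j|c|c w cw IH|c w cw IH] u v.
- case: u => [|? [|? ?]] //; case: v => [|? ?] //= [<-].
  exact: letter_class_square.
- by case: u => [|? [|? [|? ?]]].
- by case: u => [|a u] //= [-> e]; apply: letter_class_cons; apply: IH.
- case/lastP: v => [|v a].
    by rewrite cats0 cats1 => /rcons_inj[].
  rewrite -!rcons_cat => /rcons_inj[e ->].
  by apply: letter_class_rcons; apply: IH.
Qed.

(** Modulo the square relation, the cube relation says that [b] times [(val b).1] is [(val b).2];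
    this is the form treated here. *)
Lemma letter_class_product_contract j b u v :
  letter_class j (u ++ [:: inl b; inr (val b).1] ++ v) ->
  letter_class j (u ++ [:: inr (val b).2] ++ v).
Proof.
move e: (u ++ _) => w jw; elim: jw u v e => {j w} [j|c|c w cw IH|c w cw IH] u v.
- by case: u => [|? [|? ?]].
- by case: u => [|? [|? [|? ?]]].
- case: u => [|a u] /= [].
    (* The shorter word contains the letter of its own index, hence is that letter alone and [v] is
       empty. *)
    move=> -> e; rewrite -e in cw *.
    have [|_ /(_ erefl)] := letter_class_top (a := inr (val c).1) cw.
      exact: mem_head.
    by case=> ->; exact: letter_class_letter.
  by move=> -> e; apply: letter_class_cons; apply: IH.
- case/lastP: v => [|v a].
    by rewrite cats0 -[[:: _; _]]/(rcons [:: _] _) -rcons_cat => /rcons_inj[].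
  rewrite -!rcons_cat => /rcons_inj[e ->].
  by apply: letter_class_rcons; apply: IH.
Qed.

Lemma letter_class_product_expand j b u v :
  letter_class j (u ++ [:: inr (val b).2] ++ v) ->
  letter_class j (u ++ [:: inl b; inr (val b).1] ++ v).
Proof.
move e: (u ++ _) => w jw; elim: jw u v e => {j w} [j|c|c w cw IH|c w cw IH] u v.
- case: u => [|? [|? ?]] //; case: v => [|? ?] //= [<-].
  by apply: letter_class_cons; exact: letter_class_letter.
- by case: u => [|? [|? [|? ?]]].
- by case: u => [|a u] //= [-> e]; apply: letter_class_cons; apply: IH.
- case/lastP: v => [|v a].
    by rewrite cats0 cats1 => /rcons_inj[].
  rewrite -!rcons_cat => /rcons_inj[e ->].
  by apply: letter_class_rcons; apply: IH.
Qed.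

Lemma rho_syntactic j (x y : free_monoid (alphabet R)) :
  rho R x y -> @syntactic (free_monoid (alphabet R)) (letter_class j) x y.
Proof.
case=> b u v; rewrite -!mulgA; split.
- exact: letter_class_square_contract.
- exact: letter_class_square_expand.
(* The cube is read as [b] followed by a square, which is contracted first. *)
- have := @letter_class_square_contract j b (u ++ [:: inl b]) v.
  by rewrite -!catA => X /X; exact: letter_class_product_contract.
- have := @letter_class_square_expand j b (u ++ [:: inl b]) v.
  by rewrite -!catA => X /letter_class_product_expand/X.
Qed.

Lemma gen_congruence_letter i j :
  gen_congruence (rho R) ([:: inr i] : free_monoid (alphabet R)) [:: inr j] ->
  i = j.
Proof.
move=> /(gen_congruence_syntactic (@rho_syntactic j)) [_].
by move=> /(_ (letter_class_letter j)) /letter_class_inr.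
Qed.

Definition letter i : quotient_semigroup (rho R) :=
  (\pi_(quotient_semigroup (rho R)) ([:: inr i] : free_monoid (alphabet R)))%qT.

Lemma letter_inj : injective letter.
Proof. by move=> i j /eqquotP/asboolP/gen_congruence_letter. Qed.

Lemma pi_rho x y : rho R x y ->
  (x = y %[mod quotient_semigroup (rho R)])%qT.
Proof. by move=> xy; apply/eqquotP/asboolP => r _; apply. Qed.

Lemma letter_adj i j : i <> j ->
  adj (enhanced_power_graph (quotient_semigroup (rho R))) (letter i) (letter j).
Proof.
have lt_adj k l : (val l < val k)%R ->
    enhanced_power_adj (letter k) (letter l).
  move=> lk; split=> [/letter_inj e|]; first by rewrite e ltxx in lk.
  (* The letter [(k, l)] generates both: its square is [k] and its cube is [l]. *)
  pose b : B12 R := exist _ (k, l) lk.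
  pose B : free_monoid (alphabet R) := [:: inl b].
  exists (\pi_(quotient_semigroup (rho R)) B)%qT.
  split; [exists 2|exists 3] => //=.
    rewrite [RHS]quotient_mul_pi; exact/esym/(pi_rho (rho_square b)).
  rewrite [X in (_ * X)%g]quotient_mul_pi [RHS]quotient_mul_pi.
  exact/esym/(pi_rho (rho_cube b)).
move=> ij; have [lt|lt|e] := ltgtP (val i) (val j).
- by apply: enhanced_power_adj_sym; apply: lt_adj.
- exact: lt_adj.
- by case: ij; exact: val_inj.
Qed.

(** A countable set of reals has Lebesgue measure 0, whereas the interval has measure 1. *)
Lemma I12_uncountable : ~ countable [set: I12 R]%classic.
Proof.
move=> cI; have : countable `[1%R, 2%R : R]%classic.
  apply: sub_countable cI; apply: card_le_trans (card_image_le val _).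
  apply: subset_card_le => x /=; rewrite in_itv /= => x12.
  by exists (exist _ x x12).
move=> /countable_lebesgue_measure0; rewrite lebesgue_measure_itv /=.
rewrite lte_fin ltr1n => /eqP; rewrite -EFinB eqe subr_eq0.
by rewrite (eqr_nat R 2 1).
Qed.

End LetterClass.

Theorem mainTheorem10 (R : realType) :
  ~ countable (chromatic_number
      (enhanced_power_graph (quotient_semigroup (rho R)))).
Proof.
move=> cC; apply: (@I12_uncountable R); apply: sub_countable cC.
have [[c [cC cG]] _] :=
  chromatic_numberP (enhanced_power_graph (quotient_semigroup (rho R))).
(* A proper colouring is injective on a clique, so [c] composed with [letter] embeds [1,2] into the
   colours. *)
apply: (@card_le_inj _ _ (c \o @letter R)) => [i _|i j _ _ /= cij].
  exact: cC.
by apply: contrapT => /letter_adj/cG.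
Qed.
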